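(* Let $(F,s)$ be a primitive, recognisable, self-correcting mixed substitution system on a finite alphabet $\mathcal{A}$. For $i\ge 0$ let $K_i=K_{F,\sigma^i(s)}$ be the Barge–Diamond complex of $(F,\sigma^i(s))$, regarded as a subcomplex of the universal Barge–Diamond complex $K_F$, let $g_{\phi_{s_i}}\colon K_F\to K_F$ be the cellular map induced by $\phi_{s_i}$, and write $g_{\phi_{s_i}}$ also for its restriction $K_{i+1}\to K_i$. Then, as subsets of $\prod_{i\ge 0}K_F$, $$\varprojlim(K_i,g_{\phi_{s_i}})=\varprojlim(K_F,g_{\phi_{s_i}}).$$
   Context: Let $\mathcal{A}$ be a finite alphabet, $\mathcal{A}^*=\bigcup_{n\ge 1}\mathcal{A}^n$. A substitution is a map $\phi\colon\mathcal{A}\to\mathcal{A}^*$, extended to words and to bi-infinite sequences by concatenation: $\phi(\dots a_{-1}\cdot a_0a_1\dots)=\dots\phi(a_{-1})\cdot\phi(a_0)\phi(a_1)\dots$, the dot marking the boundary between positions $-1$ and $0$. Its matrix $M_\phi$ has $(i,j)$ entry the number of occurrences of the $i$th letter in the image under $\phi$ of the $j$th letter. A mixed substitution system is a pair $(F,s)$ with $F=\{\phi_0,\dots,\phi_k\}$ a finite set of substitutions on $\mathcal{A}$ and $s=(s_0,s_1,\dots)\in\{0,\dots,k\}^{\mathbb{N}}$; $\sigma$ denotes the left shift, on $s$ and on $\mathcal{A}^{\mathbb{Z}}$. Write $\phi_{s[m,n]}=\phi_{s_m}\circ\cdots\circ\phi_{s_n}$, with matrix $M_{s[m,n]}$. The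 system is (weakly) primitive if for every $n\ge 0$ there is $k\ge 1$ such that $M_{s[n,n+k]}$ has strictly positive entries. A bi-infinite sequence is admitted by $(F,s)$ if each of its finite subwords is a subword of $\phi_{s[0,n]}(a)$ for some $n\ge 0$, $a\in\mathcal{A}$. $\Sigma_{F,s}\subset\mathcal{A}^{\mathbb{Z}}$ is the space of admitted sequences, and $\mathcal{L}^2_{F,s}$ is the set of two-letter words occurring in elements of $\Sigma_{F,s}$. The tiling space is $\Omega_{F,s}=(\Sigma_{F,s}\times[0,1])/{\sim}$ with $(\mathcal{T},1)\sim(\sigma(\mathcal{T}),0)$. The continuous map $\phi_{s_i}\colon\Omega_{F,\sigma^{i+1}(s)}\to\Omega_{F,\sigma^i(s)}$ sends $(\mathcal{T},t)$, with $t\in[0,1)$ and $\mathcal{T}=\dots a_{-1}\cdot a_0a_1\dots$, to $(\sigma^{\lfloor\tilde t\rfloor}(\phi_{s_i}(\mathcal{T})),\tilde t-\lfloor\tilde t\rfloor)$, where $\tilde t=|\phi_{s_i}(a_0)|\,t$. The system is recognisable if all these maps, $i\ge 0$, are injective. For a word $w$ let $l(w)$, $r(w)$ be its leftmost and rightmost letters. $(F,s)$ is self-correcting if for every $i\ge 0$ there is $N\ge 1$ such that for all $ab\in\mathcal{A}^2$ the two-letter word $r(\phi_{s[i,i+N]}(a))\,l(\phi_{s[i,i+N]}(b))$ belongs to $\mathcal{L}^2_{F,\sigma^i(s)}$. Complexes: let $\epsilon=\min_{a\in\mathcal{A},\phi\in F}\frac{1}{2|\phi(a)|}$, $e_a=[\epsilon,1-\epsilon]\times\{a\}$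 for $a\in\mathcal{A}$, and $e_{ab}=[-\epsilon,\epsilon]\times\{ab\}$ for $ab\in\mathcal{A}^2$. The universal Barge–Diamond complex is $K_F=\left(\bigcup_{a\in\mathcal{A}}e_a\cup\bigcup_{ab\in\mathcal{A}^2}e_{ab}\right)/{\sim}$, where $(1-\epsilon,a)\sim(-\epsilon,ab)\sim(-\epsilon,ac)$ and $(\epsilon,a)\sim(\epsilon,ba)\sim(\epsilon,ca)$ for all $a,b,c\in\mathcal{A}$. The Barge–Diamond complex $K_{F,s}$ is the subcomplex consisting of all $e_a$, $a\in\mathcal{A}$, and those $e_{ab}$ with $ab\in\mathcal{L}^2_{F,s}$. For $\phi\in F$, $g_\phi\colon K_F\to K_F$: if $\phi(a)=a_1a_2\cdots a_k$, then $g_\phi$ maps $e_a$ onto the edge path $e_{a_1}\cup e_{a_1a_2}\cup\cdots\cup e_{a_{k-1}a_k}\cup e_{a_k}$ in an orientation-preserving and uniformly expanding way. On $e_{ab}$ it is the orientation-preserving identification with $e_{cd}$, where $c=r(\phi(a))$ and $d=l(\phi(b))$. *)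

(* Defs.v *)
From HB Require Import structures.
From Stdlib Require Import Relations.
From mathcomp Require Import all_boot all_order all_algebra.
From mathcomp Require Import generic_quotient zify ring lra.
From mathcomp Require Import boolp classical_sets reals.
Set Implicit Arguments.
Unset Strict Implicit.
Unset Printing Implicit Defensive.
Import Order.TTheory GRing.Theory Num.Theory.
Local Open Scope ring_scope.
Local Open Scope classical_set_scope.
Local Open Scope quotient_scope.

(* Quotient of [T] by the smallest equivalence relation containing [r]. *)
Definition glue_rel (T : choiceType) (r : T -> T -> Prop) : rel T :=
  fun x y => `[< clos_refl_sym_trans T r x y >].

Lemma glue_rel_refl (T : choiceType) (r : T -> T -> Prop) :
  reflexive (glue_rel r).
Proof. by move=> x; apply/asboolP; apply: rst_refl. Qed.

Lemma glue_rel_sym (T : choiceType) (r : T -> T -> Prop) :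
  symmetric (glue_rel r).
Proof. by move=> x y; apply/asboolP/asboolP; apply: rst_sym. Qed.

Lemma glue_rel_trans (T : choiceType) (r : T -> T -> Prop) :
  transitive (glue_rel r).
Proof.
move=> y x z /asboolP xy /asboolP yz; apply/asboolP; exact: rst_trans xy yz.
Qed.

Canonical glue_equiv (T : choiceType) (r : T -> T -> Prop) :=
  EquivRel (glue_rel r) (@glue_rel_refl T r) (@glue_rel_sym T r)
    (@glue_rel_trans T r).

Notation glue r := {eq_quot (glue_rel r)}.

Lemma glue_rel_lift (T : choiceType) (r : T -> T -> Prop) (U : Type)
    (f : T -> U) :
  (forall x y, r x y -> f x = f y) ->
  forall x, f (repr (\pi_(glue r) x)) = f x.
Proof.
move=> fr x.
have /eqmodP/asboolP : repr (\pi_(glue r) x) = x %[mod (glue r)].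
  by rewrite reprK.
move: (repr _) => y; elim=> [u v /fr //|//|u v _ -> //|u v t _ -> _ -> //].
Qed.

Record substitution (A : Type) := Substitution {
  sub_word :> A -> seq A;
  sub_word_neq0 : forall a, (0 < size (sub_word a))%N }.

Definition sub_seq (A : Type) (phi : substitution A) (w : seq A) : seq A :=
  flatten (map phi w).

Lemma size_sub_seq (A : Type) (phi : substitution A) (w : seq A) :
  (size w <= size (sub_seq phi w))%N.
Proof.
rewrite /sub_seq; elim: w => //= a w ih.
by rewrite size_cat -add1n leq_add // sub_word_neq0.
Qed.

Lemma sub_seq_cat (A : Type) (phi : substitution A) (v w : seq A) :
  sub_seq phi (v ++ w) = sub_seq phi v ++ sub_seq phi w.
Proof. by rewrite /sub_seq map_cat flatten_cat. Qed.

Lemma sub_comp_neq0 (A : Type) (phi psi : substitution A) (a : A) :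
  (0 < size (sub_seq phi (psi a)))%N.
Proof. exact: leq_trans (sub_word_neq0 psi a) (size_sub_seq _ _). Qed.

Definition sub_comp (A : Type) (phi psi : substitution A) : substitution A :=
  Substitution (sub_comp_neq0 phi psi).

Definition sub_mx (A : finType) (phi : substitution A) : 'M[nat]_#|A| :=
  \matrix_(i, j) count_mem (enum_val i) (phi (enum_val j)).

(* The words x_i x_(i+1) ... x_(i+n-1) of a bi-infinite sequence. *)
Definition subword (A : Type) (x : int -> A) (i : int) (n : nat) : seq A :=
  [seq x (i + j%:Z) | j <- iota 0 n].

Definition shiftZ (A : Type) (m : int) (x : int -> A) : int -> A :=
  fun i => x (i + m).

(* phi applied to a bi-infinite sequence: the nonnegative positions are read
   off phi(x_0 ... x_p) from the left, and position -(q+1) (= [Negz q]) off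
   phi(x_(-q-1) ... x_(-1)) from the right.  Images of letters are nonempty, so
   these words are long enough and the default of [nth] is never used. *)
Definition subZ (A : Type) (phi : substitution A) (x : int -> A) : int -> A :=
  fun z => match z with
  | Posz p => nth (x 0) (sub_seq phi (subword x 0 p.+1)) p
  | Negz q => nth (x 0) (rev (sub_seq phi (subword x (Negz q) q.+1))) q
  end.

Definition shift (I : Type) (s : nat -> I) : nat -> I := fun n => s n.+1.

Lemma iter_shiftE (I : Type) (s : nat -> I) (i n : nat) :
  iter i (@shift I) s n = s (n + i)%N.
Proof. by elim: i n => [|i ih] n; rewrite ?addn0 //= /shift ih addSnnS. Qed.

(* phi_(s[m,n]) = phi_(s_m) o ... o phi_(s_n), for m <= n. *)
Definition sub_range (A : Type) (k : nat) (F : 'I_k.+1 -> substitution A)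
    (s : nat -> 'I_k.+1) (m n : nat) : substitution A :=
  foldr (fun i psi => sub_comp (F (s i)) psi) (F (s n)) (iota m (n - m)).

Definition weakly_primitive (A : finType) (k : nat)
    (F : 'I_k.+1 -> substitution A) (s : nat -> 'I_k.+1) : Prop :=
  forall n : nat, exists k' : nat, (1 <= k')%N /\
    forall i j, (0 < sub_mx (sub_range F s n (n + k')) i j)%N.

Definition admitted (A : eqType) (k : nat) (F : 'I_k.+1 -> substitution A)
    (s : nat -> 'I_k.+1) : set (int -> A) :=
  [set x | forall (i : int) (l : nat), exists (n : nat) (a : A),
     infix (subword x i l) (sub_range F s 0 n a)].

Definition two_words (A : eqType) (k : nat) (F : 'I_k.+1 -> substitution A)
    (s : nat -> 'I_k.+1) : set (A * A) :=
  [set ab | exists2 x, admitted F s x & exists i, (x i, x (i + 1)) = ab].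

Definition leftmost (A : Type) (phi : substitution A) (a : A) : A :=
  head a (phi a).
Definition rightmost (A : Type) (phi : substitution A) (a : A) : A :=
  last a (phi a).

Definition self_correcting (A : eqType) (k : nat)
    (F : 'I_k.+1 -> substitution A) (s : nat -> 'I_k.+1) : Prop :=
  forall i : nat, exists N : nat, (1 <= N)%N /\ forall a b : A,
    two_words F (iter i (@shift _) s)
      (rightmost (sub_range F s i (i + N)) a,
       leftmost (sub_range F s i (i + N)) b).

Lemma size_subword (A : Type) (x : int -> A) i n : size (subword x i n) = n.
Proof. by rewrite size_map size_iota. Qed.

Lemma nth_subword (A : Type) (d : A) (x : int -> A) i n j :
  (j < n)%N -> nth d (subword x i n) j = x (i + j%:Z).
Proof. by move=> jn; rewrite (nth_map 0%N) ?size_iota // nth_iota. Qed.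

Lemma subwordD (A : Type) (x : int -> A) i m n :
  subword x i (m + n) = subword x i m ++ subword x (i + m%:Z) n.
Proof.
apply: (@eq_from_nth _ (x 0)) => [|j].
  by rewrite size_cat !size_subword.
rewrite size_subword => jmn; rewrite nth_cat size_subword nth_subword //.
case: ltnP => mj; rewrite nth_subword //; last by lia.
by congr x; lia.
Qed.

Lemma leq_size_sub_subword (A : Type) (phi : substitution A) (x : int -> A) i n :
  (n <= size (sub_seq phi (subword x i n)))%N.
Proof. by have := size_sub_seq phi (subword x i n); rewrite size_subword. Qed.

Lemma subZ_subword (A : Type) (phi : substitution A) (x : int -> A)
    (N : nat) (z : int) (d : A) :
  - (N%:Z) <= z -> z < N%:Z ->
  let U := sub_seq phi (subword x (- (N%:Z)) N) in
  subZ phi x z =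
  nth d (sub_seq phi (subword x (- (N%:Z)) (N + N))) (absz ((size U)%:Z + z)).
Proof.
move=> Nz zN U; rewrite subwordD sub_seq_cat -/U addNr.
have sU : (N <= size U)%N.
  exact: leq_size_sub_subword.
case: z Nz zN => [p|q] Nz zN; rewrite [LHS]/=.
  have -> : N = (p.+1 + (N - p.+1))%N by lia.
  rewrite [in RHS]subwordD sub_seq_cat.
  rewrite nth_cat ifF; last by lia.
  have -> : (absz ((size U)%:Z + p%:Z)%R - size U = p)%N by lia.
  have sp : (p < size (sub_seq phi (subword x 0 p.+1)))%N.
    exact: leq_size_sub_subword.
  by rewrite nth_cat sp; apply: set_nth_default.
rewrite nth_cat ifT; last by lia.
rewrite /U in sU *.
set V := sub_seq phi (subword x (Negz q) q.+1).
pose W := sub_seq phi (subword x (- (N%:Z)) (N - q.+1)).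
have -> : sub_seq phi (subword x (- (N%:Z)) N) = W ++ V.
  rewrite -sub_seq_cat /V; have -> : Negz q = - N%:Z + (N - q.+1)%N%:Z by lia.
  by rewrite -subwordD subnK //; lia.
have sV : (q < size V)%N.
  exact: leq_size_sub_subword.
rewrite nth_rev // size_cat nth_cat ifF; last by lia.
have -> : (absz ((size W + size V)%N%:Z + Negz q)%R - size W = size V - q.+1)%N
  by lia.
by apply: set_nth_default; lia.
Qed.

Lemma subword_subZ (A : eqType) (phi : substitution A) (x : int -> A) i n :
  exists j l, infix (subword (subZ phi x) i n) (sub_seq phi (subword x j l)).
Proof.
pose N := (`|i| + n)%N.
exists (- (N%:Z)), (N + N)%N.
set W := sub_seq _ _; pose U := sub_seq phi (subword x (- (N%:Z)) N).
have sU : (N <= size U)%N.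
  exact: leq_size_sub_subword.
have sW : (size U + N <= size W)%N.
  rewrite /W subwordD sub_seq_cat size_cat -/U leq_add2l.
  exact: leq_size_sub_subword.
pose o := absz ((size U)%:Z + i).
suff -> : subword (subZ phi x) i n = take n (drop o W).
  apply/infixP; exists (take o W), (drop n (drop o W)).
  by rewrite !cat_take_drop.
have st : size (take n (drop o W)) = n.
  by rewrite size_take size_drop; case: ltnP => //; rewrite /o; lia.
apply: (@eq_from_nth _ (x 0)) => [|j]; rewrite size_subword ?st // => jn.
rewrite nth_subword // nth_take // nth_drop.
rewrite (subZ_subword phi x (N := N) (x 0)); [|lia..].
by congr nth; rewrite /o -/U; lia.
Qed.

Lemma sub_seq_infix (A : eqType) (phi : substitution A) (v w : seq A) :
  infix v w -> infix (sub_seq phi v) (sub_seq phi w).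
Proof.
move=> /infixP[p [q ->]]; rewrite !sub_seq_cat.
by apply/infixP; exists (sub_seq phi p), (sub_seq phi q).
Qed.

Lemma sub_range_shift (A : Type) (k : nat) (F : 'I_k.+1 -> substitution A)
    (s : nat -> 'I_k.+1) (n : nat) (a : A) :
  sub_range F s 0 n.+1 a = sub_seq (F (s 0%N)) (sub_range F (shift s) 0 n a).
Proof.
rewrite /sub_range !subn0 /=; congr (sub_seq _ (sub_word _ _)).
by rewrite -[1%N]/(1 + 0)%N iotaDl foldr_map.
Qed.

Lemma admitted_subZ (A : eqType) (k : nat) (F : 'I_k.+1 -> substitution A)
    (s : nat -> 'I_k.+1) (i : nat) (x : int -> A) :
  admitted F (iter i.+1 (@shift _) s) x ->
  admitted F (iter i (@shift _) s) (subZ (F (s i)) x).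
Proof.
move=> adx j l; have [j' [l' jl]] := subword_subZ (F (s i)) x j l.
have [n [a na]] := adx j' l'; exists n.+1, a.
rewrite sub_range_shift iter_shiftE add0n.
exact: infix_trans jl (sub_seq_infix _ na).
Qed.

Lemma admitted_shiftZ (A : eqType) (k : nat) (F : 'I_k.+1 -> substitution A)
    (s : nat -> 'I_k.+1) (m : int) (x : int -> A) :
  admitted F s x -> admitted F s (shiftZ m x).
Proof.
move=> adx j l; have [n [a na]] := adx (j + m) l; exists n, a.
congr (infix _ _): na; rewrite /subword /shiftZ; apply: eq_map => h /=.
by rewrite addrAC.
Qed.

Definition unit_interval (R : realType) := {t : R | 0 <= t <= 1}.

Definition pre_tiling_space (R : realType) (A : finType) (k : nat)
    (F : 'I_k.+1 -> substitution A) (s : nat -> 'I_k.+1) : choiceType :=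
  (admitted F s * unit_interval R)%type.

Definition tiling_glue (R : realType) (A : finType) (k : nat)
    (F : 'I_k.+1 -> substitution A) (s : nat -> 'I_k.+1)
    (p q : pre_tiling_space R F s) : Prop :=
  [/\ val p.2 = 1, val q.2 = 0 & val q.1 = shiftZ 1 (val p.1)].

Definition tiling_space (R : realType) (A : finType) (k : nat)
    (F : 'I_k.+1 -> substitution A) (s : nat -> 'I_k.+1) :=
  glue (@tiling_glue R A k F s).

Lemma admittedP (A : eqType) (k : nat) (F : 'I_k.+1 -> substitution A)
    (s : nat -> 'I_k.+1) (x : admitted F s) : admitted F s (val x).
Proof. exact: set_mem (valP x). Qed.

Lemma frac_itv (R : realType) (x : R) :
  0 <= x - (Num.floor x)%:~R <= 1.
Proof.
have /andP[h1 h2] := floor_itv x; rewrite subr_ge0 h1 /=.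
by rewrite lerBlDl -(intrD R _ 1) ltW.
Qed.

Lemma unit0_itv (R : realType) : 0 <= (0 : R) <= 1.
Proof. by rewrite lexx ler01. Qed.

(* The representative of the class of a point (T, t) with t in [0,1[. *)
Definition tiling_rep (R : realType) (A : finType) (k : nat)
    (F : 'I_k.+1 -> substitution A) (s : nat -> 'I_k.+1)
    (p : pre_tiling_space R F s) : pre_tiling_space R F s :=
  if val p.2 == 1 then
    (exist _ (shiftZ 1 (val p.1))
       (mem_set (admitted_shiftZ 1 (admittedP p.1))),
     exist _ 0 (unit0_itv R))
  else p.

Definition pre_tiling_map (R : realType) (A : finType) (k : nat)
    (F : 'I_k.+1 -> substitution A) (s : nat -> 'I_k.+1) (i : nat)
    (p : pre_tiling_space R F (iter i.+1 (@shift _) s)) :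
    pre_tiling_space R F (iter i (@shift _) s) :=
  let phi := F (s i) in
  let t' := (size (phi (val p.1 0)))%:R * val p.2 in
  (exist _ (shiftZ (Num.floor t') (subZ phi (val p.1)))
     (mem_set (admitted_shiftZ _ (admitted_subZ (admittedP p.1)))),
   exist _ (t' - (Num.floor t')%:~R) (frac_itv t')).

Definition tiling_map (R : realType) (A : finType) (k : nat)
    (F : 'I_k.+1 -> substitution A) (s : nat -> 'I_k.+1) (i : nat)
    (w : tiling_space R F (iter i.+1 (@shift _) s)) :
    tiling_space R F (iter i (@shift _) s) :=
  \pi_(tiling_space R F (iter i (@shift _) s))
    (pre_tiling_map (tiling_rep (repr w))).

Lemma tiling_mapE (R : realType) (A : finType) (k : nat)
    (F : 'I_k.+1 -> substitution A) (s : nat -> 'I_k.+1) (i : nat)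
    (p : pre_tiling_space R F (iter i.+1 (@shift _) s)) :
  val p.2 < 1 ->
  tiling_map (\pi_(tiling_space R F (iter i.+1 (@shift _) s)) p) =
  \pi_(tiling_space R F (iter i (@shift _) s)) (pre_tiling_map p).
Proof.
move=> p1; rewrite /tiling_map /tiling_space.
rewrite (@glue_rel_lift _ (@tiling_glue R A k F _) _
  (@tiling_rep R A k F _)); first by rewrite /tiling_rep lt_eqF.
move=> [x t] [y u] [/= t1 u0 yx]; rewrite /tiling_rep /= t1 u0 eqxx.
rewrite eq_sym oner_eq0; congr pair; apply: val_inj => //=.
Qed.

Definition recognisable (R : realType) (A : finType) (k : nat)
    (F : 'I_k.+1 -> substitution A) (s : nat -> 'I_k.+1) : Prop :=
  forall i : nat, injective (@tiling_map R A k F s i).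

(* The default value 1/2 of the minimum is only used for an empty alphabet:
   all words F j a are nonempty. *)
Definition eps (R : realType) (A : finType) (k : nat)
    (F : 'I_k.+1 -> substitution A) : R :=
  \big[Num.min/2^-1]_(p : A * 'I_k.+1) (2 * (size (F p.2 p.1))%:R)^-1.

Lemma eps_gt0 (R : realType) (A : finType) (k : nat)
    (F : 'I_k.+1 -> substitution A) : 0 < eps R F.
Proof.
rewrite /eps; apply: (big_ind (fun x : R => 0 < x)) => [|x y x0 y0|p _].
- by rewrite invr_gt0 ltr0n.
- by rewrite lt_min x0 y0.
- by rewrite invr_gt0 mulr_gt0 ?ltr0n // sub_word_neq0.
Qed.

Lemma eps_le (R : realType) (A : finType) (k : nat)
    (F : 'I_k.+1 -> substitution A) (j : 'I_k.+1) (a : A) :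
  eps R F <= (2 * (size (F j a))%:R)^-1.
Proof. by rewrite /eps (bigD1 (a, j)) //= ge_min lexx. Qed.

Lemma eps_half (R : realType) (A : finType) (k : nat)
    (F : 'I_k.+1 -> substitution A) : eps R F <= 2^-1.
Proof.
rewrite /eps; apply: (big_ind (fun x : R => x <= 2^-1)) => [//|x y x0 y0|p _].
  by rewrite ge_min x0.
rewrite lef_pV2 ?posrE ?mulr_gt0 ?ltr0n ?sub_word_neq0 //.
by rewrite ler_peMr ?ler0n // ler1n sub_word_neq0.
Qed.

(* Index set of the edges: [inl a] for e_a and [inr (a, b)] for e_ab. *)
Definition edge (A : finType) : finType := (A + A * A)%type.

Definition in_edge (R : realType) (A : finType) (e : R) (p : R * edge A) :
    bool :=
  match p.2 with
  | inl _ => e <= p.1 <= 1 - e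
  | inr _ => - e <= p.1 <= e
  end.

Definition pre_BD (R : realType) (A : finType) (k : nat)
    (F : 'I_k.+1 -> substitution A) :=
  {p : R * edge A | in_edge (eps R F) p}.

Definition BD_glue (R : realType) (A : finType) (k : nat)
    (F : 'I_k.+1 -> substitution A) (p q : pre_BD R F) : Prop :=
  exists a b : A,
    (val p = (1 - eps R F, inl a) /\ val q = (- eps R F, inr (a, b))) \/
    (val p = (eps R F, inl a) /\ val q = (eps R F, inr (b, a))).

Definition universal_BD (R : realType) (A : finType) (k : nat)
    (F : 'I_k.+1 -> substitution A) := glue (@BD_glue R A k F).

Definition BD_complex (R : realType) (A : finType) (k : nat)
    (F : 'I_k.+1 -> substitution A) (s : nat -> 'I_k.+1) :
    set (universal_BD R F) :=
  [set z | exists2 p : pre_BD R F, z = \pi_(universal_BD R F) p &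
     match (val p).2 with
     | inl _ => True
     | inr ab => two_words F s ab
     end].

Arguments BD_complex R {A k} F s _.

(* The edge path e_(w_0), e_(w_0 w_1), ..., e_(w_(l-1)), l = size w,
   parametrised by arc length y in [e, l - e]: e_(w_i) is traversed on
   [i + e, i + 1 - e] and e_(w_(i-1) w_i) on [i - e, i + e].  For such y all
   letters read lie in w, so the default letter a is never used. *)
Definition edge_path (R : realType) (A : finType) (e : R) (a : A) (w : seq A)
    (y : R) : R * edge A :=
  let i := `|Num.floor y|%N in
  let f := y - (Num.floor y)%:~R in
  if f < e then (f, inr (nth a w i.-1, nth a w i))
  else if f <= 1 - e then (f, inl (nth a w i))
  else (f - 1, inr (nth a w i, nth a w i.+1)).

(* On e_a, the orientation preserving affine map from [e, 1 - e] onto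
   [e, |phi(a)| - e] followed by the edge path of phi(a).  If e = 1/2, all
   words of F have length 1, both intervals are points and the slope is
   irrelevant. *)
Definition raw_BD_map (R : realType) (A : finType) (e : R)
    (phi : substitution A) (p : R * edge A) : R * edge A :=
  match p.2 with
  | inl a =>
      edge_path e a (phi a)
        (e + (p.1 - e) * (((size (phi a))%:R - 2 * e) / (1 - 2 * e)))
  | inr ab => (p.1, inr (rightmost phi ab.1, leftmost phi ab.2))
  end.

Lemma raw_BD_map_in (R : realType) (A : finType) (k : nat)
    (F : 'I_k.+1 -> substitution A) (phi : substitution A) (p : pre_BD R F) :
  in_edge (eps R F) (raw_BD_map (eps R F) phi (val p)).
Proof.
have e0 := eps_gt0 R F.
case: p => -[x [a|ab]] //= pin; rewrite /raw_BD_map /edge_path /=.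
set y := (X in Num.floor X); have /andP[f0 _] := frac_itv y.
have /andP[_ f1] := floor_itv y.
have {}f1 : y - (Num.floor y)%:~R < 1 by rewrite ltrBlDl -(intrD R _ 1).
move: (y - _) f0 f1 => f f0 f1.
case: ltP => fe; first by rewrite /in_edge /=; apply/andP; split; lra.
by case: leP => fe'; rewrite /in_edge /=; apply/andP; split; lra.
Qed.

Definition pre_BD_map (R : realType) (A : finType) (k : nat)
    (F : 'I_k.+1 -> substitution A) (phi : substitution A) (p : pre_BD R F) :
    pre_BD R F :=
  exist (in_edge (eps R F)) _ (raw_BD_map_in phi p).

Definition BD_map (R : realType) (A : finType) (k : nat)
    (F : 'I_k.+1 -> substitution A) (phi : substitution A)
    (z : universal_BD R F) : universal_BD R F :=
  \pi_(universal_BD R F) (pre_BD_map phi (repr z)).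

Arguments BD_map R {A k} F phi z.

(* The maps [BD_map] for the substitutions of F are well defined on the
   quotient. *)
Lemma BD_mapE (R : realType) (A : finType) (k : nat)
    (F : 'I_k.+1 -> substitution A) (j : 'I_k.+1) (p : pre_BD R F) :
  BD_map R F (F j) (\pi_(universal_BD R F) p) =
  \pi_(universal_BD R F) (pre_BD_map (F j) p).
Proof.
rewrite /BD_map /universal_BD.
apply: (@glue_rel_lift _ (@BD_glue R A k F) _
  (fun q => \pi_(universal_BD R F) (pre_BD_map (F j) q))) => {p}.
have e0 := eps_gt0 R F; have eh := eps_half R F.
move=> p q [a [b pq]]; apply/eqmodP/asboolP/rst_step.
have l0 := sub_word_neq0 (F j) a.
have l0R : (1 <= (size (F j a))%:R :> R) by rewrite ler1n.
have he : 2 * eps R F * (size (F j a))%:R <= 1.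
  have := eps_le R F j a.
  rewrite -[(2 * _)^-1]mul1r ler_pdivlMr ?mulr_gt0 ?ltr0n //.
  by rewrite mulrA [_ * 2]mulrC.
case: pq => -[pE qE].
- exists (rightmost (F j) a), (leftmost (F j) b); left.
  rewrite /= pE qE /raw_BD_map /=; split=> //.
  have -> : eps R F + (1 - eps R F - eps R F) *
      (((size (F j a))%:R - 2 * eps R F) / (1 - 2 * eps R F)) =
      (size (F j a))%:R - eps R F.
    have [e1|e1] := eqVneq (1 - 2 * eps R F) 0; last by field.
    have -> : 1 - eps R F - eps R F = 0 by lra.
    rewrite mul0r.
    suff : (size (F j a))%:R = 1 :> R by lra.
    by apply/eqP; rewrite eq_le l0R andbT; nra.
  set l := size (F j a) in l0 l0R he *.
  have lE : l%:R = l.-1%:R + 1 :> R by rewrite natr1 prednK.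
  have fl : Num.floor (l%:R - eps R F) = l.-1.
    apply: floor_def; rewrite intrD -!pmulrn lE.
    by apply/andP; split; lra.
  rewrite /edge_path fl /=.
  have -> : l%:R - eps R F - (l.-1)%:~R = 1 - eps R F :> R.
    by rewrite -pmulrn lE; lra.
  rewrite lexx ifF; last by apply/negbTE; rewrite -leNgt; lra.
  by rewrite /rightmost -nth_last.
- exists (leftmost (F j) a), (rightmost (F j) b); right.
  rewrite /= pE qE /raw_BD_map /=; split=> //.
  rewrite subrr mul0r addr0 /edge_path.
  have -> : Num.floor (eps R F) = 0 by apply: floor_def; rewrite mulr0z; lra.
  rewrite subr0 ltxx ifT; last by lra.
  by rewrite /leftmost -nth0.
Qed.

(* Inverse limit of subspaces X_i of one space T, along the restrictions
   X_(i+1) -> X_i of maps g_i : T -> T, as a subset of the product. *)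
Definition inverse_limit (T : Type) (X : nat -> set T) (g : nat -> T -> T) :
    set (nat -> T) :=
  [set x | (forall i, X i (x i)) /\ (forall i, g i (x i.+1) = x i)].

(* Main.v *)
Require Import Defs.
From mathcomp Require Import all_boot all_order all_algebra.
From mathcomp Require Import boolp classical_sets reals.
From mathcomp Require Import generic_quotient zify lra.
Set Implicit Arguments.
Unset Strict Implicit.
Unset Printing Implicit Defensive.
Import Order.TTheory GRing.Theory Num.Theory.
Local Open Scope ring_scope.

(** An edge e_a lies in every K_i, and g maps K_(i+1) into K_i because
   applying a substitution to an admitted sequence gives an admitted sequence;
   for the edge e_a this uses that a occurs in an admitted sequence, by
   primitivity.  So a point x_(i+N+1) on some e_a forces x_i into K_i.  A point
   on some e_ab is carried to the edge e_cd with
   cd = r(phi_(s[i,i+N]) a) l(phi_(s[i,i+N]) b), which lies in K_i when N is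
   given by self-correction. *)

Lemma sub_range_recl (A : Type) (k : nat) (F : 'I_k.+1 -> substitution A)
    (s : nat -> 'I_k.+1) (m d : nat) :
  sub_range F s m (m + d.+1) =
  sub_comp (F (s m)) (sub_range F s m.+1 (m.+1 + d)).
Proof. by rewrite /sub_range !addKn /= addnS. Qed.

Lemma leftmost_comp (A : Type) (phi psi : substitution A) (a : A) :
  leftmost (sub_comp phi psi) a = leftmost phi (leftmost psi a).
Proof.
rewrite /leftmost /= /sub_seq.
case: (psi a) (sub_word_neq0 psi a) => //= b w _.
by case: (phi b) (sub_word_neq0 phi b).
Qed.

Lemma rightmost_comp (A : Type) (phi psi : substitution A) (a : A) :
  rightmost (sub_comp phi psi) a = rightmost phi (rightmost psi a).
Proof.
rewrite /rightmost /=.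
case/lastP: (psi a) (sub_word_neq0 psi a) => //= w b _.
rewrite /sub_seq map_rcons flatten_rcons last_cat last_rcons.
by case: (phi b) (sub_word_neq0 phi b).
Qed.

(** [subZ] reads position [p] off the image of [p.+1] letters. Any [n] letters with a long enough
    image serve as well, since both images are prefixes of the image of [n + p.+1] letters. *)
Lemma subZ_nth (A : Type) (phi : substitution A) (x : int -> A) (n p : nat)
    (d : A) :
  (p < size (sub_seq phi (subword x 0 n)))%N ->
  subZ phi x p%:Z = nth d (sub_seq phi (subword x 0 n)) p.
Proof.
move=> pn /=.
have pp : (p < size (sub_seq phi (subword x 0 p.+1)))%N.
  exact: leq_size_sub_subword.
have E1 : nth d (sub_seq phi (subword x 0 (n + p.+1))) p =
          nth d (sub_seq phi (subword x 0 n)) p.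
  by rewrite subwordD sub_seq_cat nth_cat pn.
rewrite -E1 addnC subwordD sub_seq_cat nth_cat pp.
exact: set_nth_default.
Qed.

Section TwoWords.
Variables (A : eqType) (k : nat) (F : 'I_k.+1 -> substitution A).
Variable s : nat -> 'I_k.+1.

Local Notation tail M := (iter M (@shift _) s).

Lemma two_words_image (M n p : nat) (x : int -> A) (d : A) :
  admitted F (tail M.+1) x ->
  let w := sub_seq (F (s M)) (subword x 0 n) in
  (p.+1 < size w)%N -> two_words F (tail M) (nth d w p, nth d w p.+1).
Proof.
move=> adx w pw; exists (subZ (F (s M)) x); first exact: admitted_subZ.
exists p%:Z; rewrite -(subZ_nth _ pw) -(subZ_nth _ (ltnW pw)).
by congr (_, subZ _ _ _); lia.
Qed.

Lemma two_words_junction (M : nat) (a b : A) :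
  two_words F (tail M.+1) (a, b) ->
  two_words F (tail M) (rightmost (F (s M)) a, leftmost (F (s M)) b).
Proof.
move=> [x adx [i [xa xb]]].
(* After a shift, [ab] stands at positions 0 and 1; the last letter of the image of [a] has index
   [(size (F (s M) a)).-1] in the image of [ab]. *)
have /(@two_words_image M 2 (size (F (s M) a)).-1 _ a) :=
  admitted_shiftZ i adx.
rewrite /subword /shiftZ /= add0r xa [1 + i]addrC xb /sub_seq /= cats0.
have a0 := sub_word_neq0 (F (s M)) a; have b0 := sub_word_neq0 (F (s M)) b.
rewrite prednK // size_cat -[X in (X < _)%N]addn0 ltn_add2l => /(_ b0).
rewrite !nth_cat prednK // leqnn ltnn subnn nth_last nth0.
by rewrite /rightmost /leftmost; case: (F (s M) b) b0.
Qed.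

Definition occurs (M : nat) (a : A) : Prop :=
  exists2 x, admitted F (tail M) x & x 0 = a.

Lemma occurs_image (M : nat) (a b : A) :
  occurs M.+1 a -> b \in (F (s M) a : seq A) -> occurs M b.
Proof.
move=> [x adx x0] /(nthP a)[p pa <-].
exists (shiftZ p%:Z (subZ (F (s M)) x)).
  exact/admitted_shiftZ/admitted_subZ.
have xE : sub_seq (F (s M)) (subword x 0 1) = F (s M) a.
  by rewrite /sub_seq /= cats0 addr0 x0.
by rewrite /shiftZ add0r (@subZ_nth _ _ _ 1 _ a) xE.
Qed.

Lemma occurs_image_range (d M : nat) (a b : A) :
  occurs (M + d).+1 a -> b \in (sub_range F s M (M + d) a : seq A) ->
  occurs M b.
Proof.
elim: d M a b => [|d ih] M a b oa.
  by rewrite /sub_range addn0 subnn /=; apply: occurs_image; rewrite -[M]addn0.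
rewrite sub_range_recl => /flatten_mapP[c ca bc].
by apply: occurs_image bc; apply: ih ca; rewrite addSnnS.
Qed.

End TwoWords.

Lemma occursT (A : finType) (k : nat) (F : 'I_k.+1 -> substitution A)
    (s : nat -> 'I_k.+1) (M : nat) (a : A) :
  weakly_primitive F s -> self_correcting F s -> occurs F s M a.
Proof.
move=> prim sc; have [d [_ pos]] := prim M.
have [N [_ /(_ a a)[x adx _]]] := sc (M + d).+1.
apply: (@occurs_image_range _ _ _ _ d _ (x 0)); first by exists x.
have := pos (enum_rank a) (enum_rank (x 0)).
by rewrite mxE !enum_rankK -has_count has_pred1.
Qed.

Lemma two_words_in_image (A : finType) (k : nat)
    (F : 'I_k.+1 -> substitution A) (s : nat -> 'I_k.+1) (M p : nat) (a d : A) :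
  weakly_primitive F s -> self_correcting F s ->
  (p.+1 < size (F (s M) a))%N ->
  two_words F (iter M (@shift _) s)
    (nth d (F (s M) a) p, nth d (F (s M) a) p.+1).
Proof.
move=> prim sc; have [x adx x0] := occursT M.+1 a prim sc.
have := @two_words_image _ _ F s M 1 p x d adx.
by rewrite /sub_seq /= cats0 addr0 x0.
Qed.

(** The bounds on [y] keep the path off the two ends of [w], so both letters of a crossed edge are
    read inside [w] and never from the default. *)
Lemma edge_path_pair (R : realType) (A : finType) (e : R) (a : A) (w : seq A)
    (y : R) (bc : A * A) :
  0 < e -> e <= y <= (size w)%:R - e -> (edge_path e a w y).2 = inr bc ->
  exists2 p, (p.+1 < size w)%N & bc = (nth a w p, nth a w p.+1).
Proof.
move=> e0 /andP[ey yl]; rewrite /edge_path.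
have /andP[] := floor_itv y; have : 0 <= Num.floor y by rewrite floor_ge0; lra.
case: (Num.floor y) => // n _; rewrite intrD -!pmulrn /= => ny yn.
have nw : (n < size w)%N by rewrite -(ltr_nat R); lra.
case: ltP => fe.
  (* With floor 0 the fractional part would be [y] itself, which is at least [e]. *)
  case: n => [|n] in ny yn nw fe *; first by exfalso; lra.
  by move=> [<-]; exists n.
case: leP => fe' // [<-]; exists n => //.
(* A fractional part above [1 - e] gives [n + 1 < y + e], which is at most [size w]. *)
by rewrite -(ltr_nat R) -natr1; lra.
Qed.

Lemma BD_map_complex (R : realType) (A : finType) (k : nat)
    (F : 'I_k.+1 -> substitution A) (s : nat -> 'I_k.+1) (M : nat)
    (z : universal_BD R F) :
  weakly_primitive F s -> self_correcting F s ->
  BD_complex R F (iter M.+1 (@shift _) s) z ->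
  BD_complex R F (iter M (@shift _) s) (BD_map R F (F (s M)) z).
Proof.
move=> prim sc [p -> Kp]; rewrite BD_mapE.
exists (pre_BD_map (F (s M)) p) => //.
case: p Kp => -[t [a|[a b]]] /= pin; last exact: two_words_junction.
move=> _; case E: (raw_BD_map _ _ _).2 => [//|bc].
have e0 := eps_gt0 R F; have eh := eps_half R F.
move: pin E; rewrite /in_edge /raw_BD_map /= => /andP[et te] E.
have l1 : 1 <= (size (F (s M) a))%:R :> R by rewrite ler1n sub_word_neq0.
suff /(edge_path_pair e0)/(_ E)[q ql ->] : eps R F <=
    eps R F + (t - eps R F) *
      (((size (F (s M) a))%:R - 2 * eps R F) / (1 - 2 * eps R F)) <=
    (size (F (s M) a))%:R - eps R F by exact: two_words_in_image.
(* In the degenerate case the inverse of 0 is 0, so the parameter is [eps R F], equal to 1/2, and a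
   word length of at least 1 gives the upper bound. *)
have [e1|e1] := eqVneq (1 - 2 * eps R F) 0.
  by rewrite e1 invr0 !mulr0; apply/andP; split; lra.
have e2 : 0 < 1 - 2 * eps R F by rewrite lt_neqAle eq_sym e1; lra.
rewrite mulrA lerDl -lerBrDl divr_ge0 ?mulr_ge0; try lra.
by rewrite ler_pdivrMr //; nra.
Qed.

(** Each map sends e_ab to a single edge by taking r and l, and these compose along [s]. Descending
    from [(i + d).+1] to [i] applies [d.+1] maps, exactly those in [sub_range F s i (i + d)]. *)
Lemma thread_vertex_edge (R : realType) (A : finType) (k : nat)
    (F : 'I_k.+1 -> substitution A) (s : nat -> 'I_k.+1)
    (x : nat -> universal_BD R F) :
  (forall i, BD_map R F (F (s i)) (x i.+1) = x i) ->
  forall (d i : nat) (p : pre_BD R F) (a b : A),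
  x (i + d).+1 = \pi_(universal_BD R F)%qT p -> (val p).2 = inr (a, b) ->
  exists2 q : pre_BD R F, x i = \pi_(universal_BD R F)%qT q &
    (val q).2 = inr (rightmost (sub_range F s i (i + d)) a,
                     leftmost (sub_range F s i (i + d)) b).
Proof.
move=> xg; have step i (p : pre_BD R F) a b :
    x i.+1 = \pi_(universal_BD R F)%qT p -> (val p).2 = inr (a, b) ->
    exists2 q : pre_BD R F, x i = \pi_(universal_BD R F)%qT q &
      (val q).2 = inr (rightmost (F (s i)) a, leftmost (F (s i)) b).
  move=> xp pE; exists (pre_BD_map (F (s i)) p); first by rewrite -xg xp BD_mapE.
  by rewrite /= /raw_BD_map pE.
elim=> [|d ih] i p a b.
  by rewrite /sub_range addn0 subnn; apply: step.
rewrite -addSnnS => /ih /[apply] -[q xq qE].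
have [r xr rE] := step _ _ _ _ xq qE; exists r => //.
by rewrite addSnnS sub_range_recl leftmost_comp rightmost_comp.
Qed.

Theorem theorem3p23 (R : realType) (A : finType) (k : nat)
    (F : 'I_k.+1 -> substitution A) (s : nat -> 'I_k.+1)
    (Hprim : weakly_primitive F s)
    (Hrec : recognisable R F s)
    (Hsc : self_correcting F s) :
  inverse_limit (fun i => BD_complex R F (iter i (@shift _) s))
                (fun i => BD_map R F (F (s i)))
  = inverse_limit (fun _ => [set: universal_BD R F]%classic)
                  (fun i => BD_map R F (F (s i))).
Proof.
apply/seteqP; split=> x /= [xK xg]; split=> // {xK} i.
have [N [_ HN]] := Hsc i.
(* The level is [(i + N).+1] because the range from [i] to [i + N] has [N.+1] substitutions. *)
case E: (val (repr (x (i + N).+1))).2 => [a|[a b]]; last first.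
  have [q -> qE] := thread_vertex_edge xg (esym (reprK _)) E.
  by exists q => //; rewrite qE.
have : BD_complex R F (iter (i + N).+1 (@shift _) s) (x (i + N).+1).
  by exists (repr (x (i + N).+1)); rewrite ?reprK // E.
(* Membership is carried down one level at a time until level [i]. *)
elim: (i + N).+1 (leq_addr N i : (i < (i + N).+1)%N) => // n ih.
rewrite ltnS leq_eqVlt => /orP[/eqP <-|/ih{}ih] /(BD_map_complex Hprim Hsc).
  by rewrite xg.
by rewrite xg.
Qed.
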